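(* Let $T=(t_{ij})\in\mathcal{A}_{1\to\infty}^{(n)}(\mathbb{R})$ with $\operatorname{rank}(T)=r$, and suppose that $t_{ii}=1$ for $1\le i\le m$ and $t_{ii}<1$ for $m+1\le i\le n$. Let $A=(a_{ij})\in M_n(\mathbb{R})$ be an orthogonal matrix with $T=A\Gamma A^T$, where $\Gamma=\operatorname{diag}(\lambda_1,\dots,\lambda_r,0,\dots,0)$ and $\lambda_1\ge\cdots\ge\lambda_r>0$ are the non-zero eigenvalues of $T$. Then the following are equivalent. (i) $T$ is an extreme contraction, i.e. an extreme point of $\mathcal{A}_{1\to\infty}^{(n)}(\mathbb{R})$. (ii) $\operatorname{rank}(L)=\frac{r^2+r}{2}$, where $L:V\to\mathbb{R}^m$ is the linear operator described in the context. (iii) $\operatorname{rank}(\tilde A)=\frac{r^2+r}{2}$, where $\tilde A=[P\ Q]\in M_{m\times\frac{r^2+r}{2}}(\mathbb{R})$ with $P\in M_{m\times r}(\mathbb R)$ and $Q\in M_{m\times\frac{r(r-1)}{2}}(\mathbb R)$; the $s$-th column of $P$ is $(|a_{1s}|^2,\dots,|a_{ms}|^2)^T$ for $1\le s\le r$, and the $(p,l)$-th column of $Q$ is $(2a_{1p}a_{1l},\dots,2a_{mp}a_{ml})^T$ for $1\le p<l\le r$.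
   Context: $\mathcal{A}_{1\to\infty}^{(n)}(\mathbb{R})=\{T\in M_n(\mathbb{R}):T\ge0,\ \|T\|_{\ell_1^n\to\ell_\infty^n}\le1\}$, where $T\ge0$ means symmetric non-negative definite and matrices act as operators with respect to the canonical basis. An extreme contraction is an extreme point of this convex set. $V$ is the real vector space of dimension $\frac{r^2+r}{2}$ of tuples $C'=(c_{jj},c_{pl})_{1\le j\le r,\ 1\le p<l\le r}$ with real entries (the coordinates of a symmetric matrix in $M_r(\mathbb{R})$), and $$L(C')_s=\sum_{p=1}^r|a_{sp}|^2c_{pp}+\sum_{1\le p<l\le r}2a_{sp}a_{sl}\,c_{pl},\qquad 1\le s\le m.$$ *)

(* Defs.v *)
From HB Require Import structures.
From mathcomp Require Import all_boot all_order all_algebra.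
From mathcomp Require Import all_classical all_reals.
From mathcomp Require Import matrix_normedtype.

Set Implicit Arguments.
Unset Strict Implicit.
Unset Printing Implicit Defensive.

Import Order.TTheory GRing.Theory Num.Theory.
Local Open Scope classical_set_scope.
Local Open Scope ring_scope.

Definition l1_norm (R : realType) (n : nat) (x : 'cV[R]_n) : R :=
  \sum_(i < n) `|x i 0|.

(* On a column, [mx_norm] is the maximum of the moduli of the entries. *)
Definition linf_norm (R : realType) (n : nat) (x : 'cV[R]_n) : R := mx_norm x.

Definition norm_l1_linf (R : realType) (n : nat) (T : 'M[R]_n) : R :=
  sup [set linf_norm (T *m x) | x in [set x : 'cV[R]_n | l1_norm x <= 1]].

(* The supremum is not the junk value given to unbounded or empty sets. *)
Lemma norm_l1_linf_has_sup (R : realType) (n : nat) (T : 'M[R]_n) :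
  has_sup [set linf_norm (T *m x) | x in [set x : 'cV[R]_n | l1_norm x <= 1]].
Proof.
split.
  exists (linf_norm (T *m 0)), 0 => //=.
  by rewrite /l1_norm big1 ?ler01// => i _; rewrite mxE normr0.
have mxle p q (M : 'M[R]_(p, q)) i j : `|M i j| <= mx_norm M.
  rewrite mx_normrE.
  exact: (le_bigmax _ (fun ij : 'I_p * 'I_q => `|M ij.1 ij.2|) (i, j)).
have T0 : 0 <= mx_norm T by exact: (normr_ge0 T).
exists (mx_norm T) => _ [x /= x1 <-].
rewrite /linf_norm mx_normrE; apply: bigmax_le => // ij _.
rewrite mxE (le_trans (ler_norm_sum _ _ _))//.
apply: (@le_trans _ _ (mx_norm T * l1_norm x)); last by rewrite ler_piMr.
rewrite mulr_sumr; apply: ler_sum => k _.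
by rewrite normrM (ord1 ij.2) ler_wpM2r.
Qed.

Definition nonneg_definite (R : realType) (n : nat) (T : 'M[R]_n) : Prop :=
  T^T = T /\ forall x : 'cV[R]_n, 0 <= (x^T *m T *m x) 0 0.

Definition psd_contractions (R : realType) (n : nat) : set 'M[R]_n :=
  [set T | nonneg_definite T /\ norm_l1_linf T <= 1].

Definition extreme_point (R : realType) (E : lmodType R) (K : set E) (x : E)
    : Prop :=
  K x /\ forall (y z : E) (t : R), K y -> K z -> 0 < t -> t < 1 ->
    x = t *: y + (1 - t) *: z -> y = x /\ z = x.

Definition extreme_contraction (R : realType) (n : nat) (T : 'M[R]_n) : Prop :=
  extreme_point (@psd_contractions R n) T.

Definition orthogonal_mx (R : realType) (n : nat) (A : 'M[R]_n) : Prop :=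
  A^T *m A = 1%:M /\ A *m A^T = 1%:M.

(* diag(lam 0, ..., lam (r - 1), 0, ..., 0); only the values of [lam] below
   [r] matter. *)
Definition diag_lam (R : realType) (n r : nat) (lam : nat -> R) : 'M[R]_n :=
  diag_mx (\row_(j < n) if (j < r)%N then lam j else 0).

Definition upper_left (R : realType) (n m r : nat) (hm : (m <= n)%N)
    (hr : (r <= n)%N) (A : 'M[R]_n) : 'M[R]_(m, r) :=
  \matrix_(s < m, p < r) A (widen_ord hm s) (widen_ord hr p).

Notation upair r := {pl : 'I_r * 'I_r | (pl.1 < pl.2)%N}.

Lemma card_upair (r : nat) : #|{: upair r}| = (r * r.-1)./2.
Proof.
rewrite card_sig -sum1_card.
rewrite -(pair_big_dep xpredT (fun p l : 'I_r => (p < l)%N) (fun _ _ => 1%N)) /=.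
rewrite (exchange_big_dep xpredT)//= -bin2 -bin2_sum big_mkord.
apply: eq_bigr => l _.
by rewrite -(big_ord_widen r (fun=> 1%N)) ?(ltnW (ltn_ord l))// sum1_card card_ord.
Qed.

(* The tuple (c_jj, c_pl) is split into its diagonal family and the family
   indexed by the pairs p < l. *)
Definition sym_coords (R : realType) (r : nat) : vectType R :=
  ({ffun 'I_r -> R^o} * {ffun upair r -> R^o})%type.

Lemma dim_sym_coords (R : realType) (r : nat) :
  \dim (fullv : {vspace sym_coords R r}) = ((r ^ 2 + r) %/ 2)%N.
Proof.
rewrite dimvf /=.
have -> : dim (sym_coords R r) = (#|'I_r| * 1 + #|{: upair r}| * 1)%N by [].
rewrite !muln1 card_ord card_upair.
rewrite -bin2 -{1}(bin1 r) addnC -binS bin2 divn2 /=.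
by rewrite -mulnn -mulnSr mulnC.
Qed.

Definition Lmap (R : realType) (m r : nat) (a : 'M[R]_(m, r))
    (c : sym_coords R r) : 'cV[R]_m :=
  \col_(s < m) (\sum_(p < r) `|a s p| ^+ 2 * c.1 p
    + \sum_(pl : upair r)
        2 * a s (val pl).1 * a s (val pl).2 * c.2 pl).

Lemma Lmap_is_linear (R : realType) (m r : nat) (a : 'M[R]_(m, r)) :
  linear (Lmap a).
Proof.
move=> k u v; apply/matrixP => s j; rewrite !mxE mulrDr !mulr_sumr.
rewrite addrACA -!big_split /=; congr (_ + _); apply: eq_bigr => i _.
  by rewrite !ffunE mulrDr mulrCA.
by rewrite !ffunE mulrDr mulrCA.
Qed.

HB.instance Definition _ (R : realType) (m r : nat) (a : 'M[R]_(m, r)) :=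
  GRing.isLinear.Build R (sym_coords R r) 'cV[R]_m _ (Lmap a)
    (Lmap_is_linear a).

Definition L (R : realType) (m r : nat) (a : 'M[R]_(m, r)) :
  'Hom(sym_coords R r, 'cV[R]_m) := linfun (Lmap a).

Definition lrank (R : realType) (U W : vectType R) (f : 'Hom(U, W)) : nat :=
  \dim (limg f).

Definition Pmx (R : realType) (m r : nat) (a : 'M[R]_(m, r)) : 'M[R]_(m, r) :=
  \matrix_(i < m, s < r) `|a i s| ^+ 2.

(* The columns follow the enumeration of the pairs p < l. *)
Definition Qmx (R : realType) (m r : nat) (a : 'M[R]_(m, r)) :
    'M[R]_(m, (r * r.-1)./2) :=
  \matrix_(i < m, k < (r * r.-1)./2)
    let pl := val (enum_val (cast_ord (esym (card_upair r)) k)) in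
    2 * a i pl.1 * a i pl.2.

Definition Atilde (R : realType) (m r : nat) (a : 'M[R]_(m, r)) :
    'M[R]_(m, r + (r * r.-1)./2) := row_mx (Pmx a) (Qmx a).

(* Main.v *)
(** A positive semidefinite matrix is a contraction from l_1 to l_oo exactly
    when its diagonal entries are at most 1. Write T = B D B^T with B the first
    r columns of A and D = diag(lam). If T = t Y + (1 - t) Z in the convex set,
    then ker T is contained in ker Y and ker Z, so Y - Z = B C B^T with C
    symmetric, and Y - Z vanishes on the diagonal entries where T equals 1.
    Conversely, for such a C and small e, the matrices T +- e B C B^T stay in the
    set, since D +- e C is diagonally dominant. So T is extreme iff the only
    such C is 0, and that is injectivity of L. *)
Require Import Defs.
From HB Require Import structures.
From mathcomp Require Import all_boot all_order all_algebra.
From mathcomp Require Import all_classical all_reals.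
From mathcomp Require Import matrix_normedtype zify ring lra.
Set Implicit Arguments.
Unset Strict Implicit.
Unset Printing Implicit Defensive.
Import Order.TTheory GRing.Theory Num.Theory.
Local Open Scope ring_scope.

(** * Quadratic forms, and the convex set in terms of matrix entries *)

Definition bil (R : realType) (n : nat) (Y : 'M[R]_n) (x y : 'cV[R]_n) : R :=
  (x^T *m Y *m y) 0 0.

Definition quad (R : realType) (n : nat) (Y : 'M[R]_n) (x : 'cV[R]_n) : R :=
  bil Y x x.

Lemma bilE (R : realType) (n : nat) (Y : 'M[R]_n) (x y : 'cV[R]_n) :
  bil Y x y = \sum_i \sum_j x i 0 * Y i j * y j 0.
Proof.
rewrite /bil mxE exchange_big /=; apply: eq_bigr => j _.
by rewrite mxE mulr_suml; apply: eq_bigr => i _; rewrite mxE.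
Qed.

Lemma quadD (R : realType) (n : nat) (Y : 'M[R]_n) (x y : 'cV[R]_n) (c : R) :
  quad Y (x + c *: y)
  = quad Y x + c * (bil Y x y + bil Y y x) + c ^+ 2 * quad Y y.
Proof.
rewrite /quad !bilE -big_split !mulr_sumr -!big_split /=.
apply: eq_bigr => i _; rewrite -big_split !mulr_sumr -!big_split /=.
by apply: eq_bigr => j _; rewrite !mxE; ring.
Qed.

Lemma bil_delta (R : realType) (n : nat) (Y : 'M[R]_n) (i j : 'I_n) :
  bil Y (delta_mx i 0) (delta_mx j 0) = Y i j.
Proof. by rewrite /bil trmx_delta -rowE -colE !mxE. Qed.

(** The form is non-negative at both [e_i + e_j] and [e_i - e_j]. *)
Lemma psd_entry_le (R : realType) (n : nat) (Y : 'M[R]_n) (i j : 'I_n) :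
  nonneg_definite Y -> 2 * `|Y i j| <= Y i i + Y j j.
Proof.
move=> [Ysym Ypsd].
have Eji : Y j i = Y i j by rewrite -[in LHS]Ysym mxE.
have := Ypsd (delta_mx i 0 + 1 *: delta_mx j 0).
have := Ypsd (delta_mx i 0 + (- 1) *: delta_mx j 0).
rewrite -!/(bil _ _ _) -!/(quad _ _) !quadD /quad !bil_delta Eji.
by case: (ger0P (Y i j)) => ?; lra.
Qed.

Lemma l1_norm_delta (R : realType) (n : nat) (j : 'I_n) :
  l1_norm (delta_mx j 0 : 'cV[R]_n) = 1.
Proof.
rewrite /l1_norm (bigD1 j) //= big1 => [|i ij]; rewrite !mxE ?eqxx ?normr1 ?addr0//.
by rewrite (negbTE ij) normr0.
Qed.

(** The columns of [Y] are the images of the basis vectors, which lie in the l_1 ball; conversely,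
    entries of modulus at most 1 bound each coordinate of [Y *m x] by the l_1 norm of [x]. *)
Lemma norm_l1_linf_le1 (R : realType) (n : nat) (Y : 'M[R]_n) :
  norm_l1_linf Y <= 1 <-> (forall i j, `|Y i j| <= 1).
Proof.
split=> [Y1 i j|Y1].
  apply: le_trans Y1; apply: (@le_trans _ _ (linf_norm (Y *m delta_mx j 0))).
    rewrite /linf_norm -colE mx_normrE.
    have := le_bigmax 0 (fun ij : 'I_n * 'I_1 => `|col j Y ij.1 ij.2|) (i, 0).
    by rewrite /= mxE.
  apply: ub_le_sup; first by have [] := norm_l1_linf_has_sup Y.
  by exists (delta_mx j 0) => //=; rewrite l1_norm_delta.
apply: ge_sup; first by have [] := norm_l1_linf_has_sup Y.
move=> _ [x /= x1 <-]; rewrite /linf_norm mx_normrE; apply: bigmax_le => // ij _.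
rewrite mxE (le_trans (ler_norm_sum _ _ _))//; apply: le_trans x1.
by apply: ler_sum => k _; rewrite normrM (ord1 ij.2) ler_piMl.
Qed.

Lemma psd_contractionsE (R : realType) (n : nat) (Y : 'M[R]_n) :
  psd_contractions Y <-> nonneg_definite Y /\ forall i, Y i i <= 1.
Proof.
split=> -[Ypsd Y1]; split=> //.
  by move=> i; rewrite (le_trans (ler_norm _))// (norm_l1_linf_le1 _).1.
apply/(norm_l1_linf_le1 _).2 => i j.
by have := psd_entry_le i j Ypsd; have := Y1 i; have := Y1 j; lra.
Qed.

(** With [w = Y *m x] and [s] the squared length of [w], the form at [x - e *: w] is
    [e ^+ 2 * quad Y w - 2 * e * s], which is negative for small positive [e] unless [w = 0]. *)
Lemma psd_quad0 (R : realType) (n : nat) (Y : 'M[R]_n) (x : 'cV[R]_n) :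
  nonneg_definite Y -> quad Y x = 0 -> Y *m x = 0.
Proof.
move=> [Ysym Ypsd] qx0; set w := Y *m x.
pose s := \sum_i w i 0 ^+ 2.
have s0 : 0 <= s by apply: sumr_ge0 => i _; rewrite sqr_ge0.
have bww : bil Y w x = s.
  by rewrite /bil -mulmxA mxE; apply: eq_bigr => i _; rewrite mxE expr2.
have bxw : bil Y x w = s.
  rewrite /bil -[Y]Ysym -trmx_mul mxE.
  by apply: eq_bigr => i _; rewrite mxE expr2.
have q0 : 0 <= quad Y w := Ypsd w.
have qE (e : R) : 0 <= e ^+ 2 * quad Y w - 2 * e * s.
  have := Ypsd (x + (- e) *: w); rewrite -/(bil _ _ _) -/(quad _ _) quadD.
  by rewrite qx0 bww bxw; lra.
suff s00 : s = 0.
  apply/colP => i; rewrite [RHS]mxE; apply/eqP; rewrite -sqrf_eq0.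
  have /psumr_eq0P/(_ s00) H : forall i : 'I_n, true -> 0 <= w i 0 ^+ 2.
    by move=> k _; rewrite sqr_ge0.
  by rewrite H.
apply/eqP; rewrite eq_le s0 andbT.
have q1 : 0 < quad Y w + 1 by lra.
have e0 : 0 < (quad Y w + 1)^-1 by rewrite invr_gt0.
have e1 : (quad Y w + 1)^-1 * quad Y w <= 1 by rewrite mulrC ler_pdivrMr//; lra.
(* Dividing by [quad Y w + 1] avoids a zero denominator and keeps [e * quad Y w - 2] negative. *)
have := qE (s * (quad Y w + 1)^-1); set e := _^-1 in e0 e1 *.
have -> : (s * e) ^+ 2 * quad Y w - 2 * (s * e) * s
  = s ^+ 2 * e * (e * quad Y w - 2) by ring.
move=> H; rewrite leNgt; apply/negP => sp; move: H; apply/negP; rewrite -ltNge.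
by rewrite pmulr_rlt0 ?mulr_gt0 ?exprn_gt0//; lra.
Qed.

(** * Small perturbations that stay positive semidefinite *)

(** Gives one step size for finitely many constraints: the inverse of a number above every ratio
    [g i / f i]. The summand 1 keeps that number positive. *)
Lemma exists_small (R : realType) (I : finType) (f g : I -> R) :
  (forall i, 0 < f i) -> (forall i, 0 <= g i) ->
  exists2 e, 0 < e & forall i, e * g i <= f i.
Proof.
move=> f0 g0; pose M := 1 + \sum_i g i / f i.
have S0 i : 0 <= g i / f i by rewrite divr_ge0// ltW.
have M0 : 0 < M by rewrite ltr_wpDr// sumr_ge0.
exists M^-1; first by rewrite invr_gt0.
move=> i; rewrite mulrC ler_pdivrMr// mulrC -ler_pdivrMr//.
by rewrite /M (bigD1 i)//= addrCA lerDl addr_ge0// sumr_ge0.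
Qed.

(** Each product [x_p x_q] is at most the mean of the two squares in modulus, and the symmetry of
    [C] lets both halves be charged to row sums. The row sums include the diagonal entry of [C]. *)
Lemma diag_dominant_psd (R : realType) (r : nat) (d : 'rV[R]_r) (C : 'M[R]_r) :
  C^T = C -> (forall p, \sum_q `|C p q| <= d 0 p) ->
  nonneg_definite (diag_mx d + C).
Proof.
move=> Csym Cd; split=> [|x]; first by rewrite linearD /= tr_diag_mx Csym.
have Csw p q : C q p = C p q by rewrite -[in LHS]Csym mxE.
rewrite -/(bil _ _ _) -/(quad _ _).
have -> : quad (diag_mx d + C) x = quad (diag_mx d) x + quad C x.
  by rewrite /quad /bil mulmxDr mulmxDl mxE.
have -> : quad (diag_mx d) x = \sum_p d 0 p * x p 0 ^+ 2.
  rewrite /quad bilE; apply: eq_bigr => p _; rewrite (bigD1 p)//= big1 => [|q qp].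
    by rewrite mxE eqxx mulr1n; ring.
  by rewrite mxE eq_sym (negbTE qp) mulr0n; ring.
have : - (\sum_p \sum_q `|C p q| * ((x p 0 ^+ 2 + x q 0 ^+ 2) / 2)) <= quad C x.
  rewrite /quad bilE -sumrN; apply: ler_sum => p _; rewrite -sumrN; apply: ler_sum => q _.
  rewrite lerNl (le_trans (ler_norm _))// normrN !normrM mulrAC mulrC.
  apply: ler_wpM2l => //.
  rewrite -[x p 0 ^+ 2]real_normK ?num_real// -[x q 0 ^+ 2]real_normK ?num_real//.
  by have := sqr_ge0 (`|x p 0| - `|x q 0|); nra.
have -> : \sum_p \sum_q `|C p q| * ((x p 0 ^+ 2 + x q 0 ^+ 2) / 2)
    = \sum_p (\sum_q `|C p q|) * x p 0 ^+ 2.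
  pose h := \sum_p \sum_q `|C p q| * (x p 0 ^+ 2 / 2).
  transitivity (h + h).
    have {2}-> : h = \sum_p \sum_q `|C p q| * (x q 0 ^+ 2 / 2).
      rewrite /h exchange_big; apply: eq_bigr => p _; apply: eq_bigr => q _.
      by rewrite Csw.
    rewrite -big_split /=; apply: eq_bigr => p _.
    by rewrite -big_split /=; apply: eq_bigr => q _; field.
  rewrite -big_split /=; apply: eq_bigr => p _.
  by rewrite -big_split /= mulr_suml; apply: eq_bigr => q _; field.
have : \sum_p (\sum_q `|C p q|) * x p 0 ^+ 2 <= \sum_p d 0 p * x p 0 ^+ 2.
  by apply: ler_sum => p _; rewrite ler_wpM2r ?sqr_ge0.
by lra.
Qed.

Lemma psd_congr (R : realType) (n r : nat) (B : 'M[R]_(n, r)) (M : 'M[R]_r) :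
  nonneg_definite M -> nonneg_definite (B *m M *m B^T).
Proof.
move=> [Msym Mpsd]; split=> [|x]; first by rewrite !trmx_mul trmxK Msym mulmxA.
by have := Mpsd (B^T *m x); rewrite trmx_mul trmxK !mulmxA.
Qed.

(** * The extremality criterion *)

Lemma extreme_contractionP (R : realType) (n r : nat) (B : 'M[R]_(n, r))
    (d : 'rV[R]_r) (T : 'M[R]_n) :
  B^T *m B = 1%:M -> (forall p, 0 < d 0 p) -> T = B *m diag_mx d *m B^T ->
  psd_contractions T ->
  extreme_contraction T <->
  (forall C : 'M[R]_r, C^T = C ->
    (forall i, T i i = 1 -> (B *m C *m B^T) i i = 0) -> C = 0).
Proof.
move=> BB d0 TE KT; have [_ T1] := (psd_contractionsE T).1 KT.
split=> [[_ ext] C Csym CT|inj].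
  set S := B *m C *m B^T in CT.
  (* Two families of constraints: diagonal dominance in each row of [diag_mx d + k *: C], and the
     slack [1 - T i i] of each diagonal entry. Where the slack is 0, [S i i] vanishes and 1 is a
     dummy positive bound. *)
  pose f (i : 'I_r + 'I_n) : R :=
    match i with inl p => d 0 p | inr i => if T i i == 1 then 1 else 1 - T i i
    end.
  pose g (i : 'I_r + 'I_n) : R :=
    match i with inl p => \sum_q `|C p q| | inr i => `|S i i| end.
  have [|[p|i] /=|e e0 efg] := @exists_small R _ f g.
  - case=> [p|i] //=; case: eqP => // /eqP Ti; rewrite subr_gt0.
    by rewrite lt_neqAle Ti T1.
  - by apply: sumr_ge0.
  - by [].
  have KS (k : R) : `|k| = e -> psd_contractions (T + k *: S).
    move=> ke; apply/psd_contractionsE; split.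
      have -> : T + k *: S = B *m (diag_mx d + k *: C) *m B^T.
        by rewrite TE mulmxDr mulmxDl -scalemxAr -scalemxAl.
      apply/psd_congr/diag_dominant_psd => [|p]; first by rewrite linearZ /= Csym.
      apply: le_trans (efg (inl p)); rewrite mulr_sumr; apply: ler_sum => q _.
      by rewrite mxE normrM ke.
    move=> i; rewrite mxE [X in _ + X]mxE; have := efg (inr i) => /=.
    case: eqP => [Ti _|_]; first by rewrite CT// mulr0 addr0 Ti.
    by rewrite -ke -normrM; have := ler_norm (k * S i i); lra.
  have [] := ext (T + e *: S) (T + (- e) *: S) (2^-1).
  - by apply: KS; rewrite gtr0_norm.
  - by apply: KS; rewrite normrN gtr0_norm.
  - by lra.
  - by lra.
  - by apply/matrixP => i j; rewrite !mxE; field.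
  move=> /eqP; rewrite -subr_eq0 addrC addKr scaler_eq0 gt_eqF//= => /eqP S0 _.
  have -> : C = B^T *m S *m B.
    by rewrite /S !mulmxA BB mul1mx -mulmxA BB mulmx1.
  by rewrite S0 mulmx0 mul0mx.
split=> // Y Z t KY KZ t0 t1 TYZ.
have [[Ysym Ypsd] Y1] := (psd_contractionsE Y).1 KY.
have [[Zsym Zpsd] Z1] := (psd_contractionsE Z).1 KZ.
(* The columns of the complementary projection [1%:M - B *m B^T] lie in the kernel of [T]. *)
have TB : T *m (1%:M - B *m B^T) = 0.
  by rewrite mulmxBr mulmx1 TE !mulmxA -[_ *m B^T *m B]mulmxA BB mulmx1 subrr.
have kerT (x : 'cV[R]_n) : T *m x = 0 -> Y *m x = 0 /\ Z *m x = 0.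
  move=> Tx; have : quad T x = 0 by rewrite /quad /bil -mulmxA Tx mulmx0 mxE.
  have -> : quad T x = t * quad Y x + (1 - t) * quad Z x.
    rewrite /quad /bil TYZ mulmxDr mulmxDl mxE -!scalemxAr -!scalemxAl.
    by rewrite mxE [X in _ + X]mxE.
  have Yx : 0 <= quad Y x by apply: Ypsd.
  have Zx : 0 <= quad Z x by apply: Zpsd.
  move=> q0; split; apply: psd_quad0 => //; nra.
(* A matrix that kills the kernel of [T] absorbs the projection [B *m B^T] on the right, and by
   symmetry on the left. *)
have compress (W : 'M[R]_n) : W^T = W ->
    (forall x : 'cV_n, T *m x = 0 -> W *m x = 0) ->
    W = B *m (B^T *m W *m B) *m B^T.
  move=> Wsym kerW.
  have WB : W *m (B *m B^T) = W.
    apply/eqP; rewrite eq_sym -subr_eq0 -[X in X - _]mulmx1 -mulmxBr; apply/eqP.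
    apply/matrixP => i j; rewrite [RHS]mxE.
    have -> : (W *m (1%:M - B *m B^T)) i j = col j (W *m (1%:M - B *m B^T)) i 0.
      by rewrite [RHS]mxE.
    by rewrite colE -mulmxA kerW ?mxE// mulmxA TB mul0mx.
  have BW : B *m B^T *m W = W.
    by rewrite -[RHS]Wsym -[in RHS]WB !trmx_mul trmxK Wsym.
  by rewrite !mulmxA BW -mulmxA WB.
pose C := B^T *m (Y - Z) *m B.
have SE : B *m C *m B^T = Y - Z.
  rewrite /C -compress// ?linearB/= ?Ysym ?Zsym// => x /kerT[Yx Zx].
  by rewrite mulmxBl Yx Zx subrr.
have C0 : C = 0.
  apply: inj => [|i Ti].
    by rewrite /C !trmx_mul trmxK linearB /= Ysym Zsym mulmxA.
  (* A proper convex combination of two numbers at most 1 equals 1 only if both are 1. *)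
  rewrite SE mxE [X in _ + X]mxE; move: Ti; rewrite TYZ mxE mxE [X in _ + X]mxE.
  by have := Y1 i; have := Z1 i; nra.
have YZ : Y = Z by apply/eqP; rewrite -subr_eq0 -SE C0 mulmx0 mul0mx.
have YT : Y = T by rewrite TYZ -YZ -scalerDl addrC subrK scale1r.
by split=> //; rewrite -YZ.
Qed.

(** * Coordinates of symmetric matrices and injectivity of [L] *)

(** The positions [(p, l)] and [(l, p)] contribute equally; this is where the factor 2 in [Lmap]
    comes from. *)
Lemma sum_sym_upair (R : realType) (r : nat) (F : 'I_r -> 'I_r -> R) :
  (forall p l, F p l = F l p) ->
  \sum_p \sum_l F p l =
  \sum_p F p p + \sum_(pl : upair r) 2 * F (val pl).1 (val pl).2.
Proof.
move=> Fsym.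
have upE (G : 'I_r * 'I_r -> R) :
    \sum_(pl : upair r) G (val pl) = \sum_(p < r) \sum_(l < r | (p < l)%N) G (p, l).
  rewrite pair_big_dep /= (reindex_omap (val : upair r -> _) insub) /=.
    apply: eq_big => [[[p l] /= pl]|[[p l] pl] _] //=.
    by rewrite insubT eqxx pl.
  by case=> p l /= pl; rewrite insubT.
have rowE p : \sum_l F p l
    = F p p + (\sum_(l < r | (p < l)%N) F p l + \sum_(l < r | (l < p)%N) F p l).
  rewrite (bigD1 p)//= (bigID (fun l : 'I_r => (p < l)%N)) /=.
  congr (_ + (_ + _)); apply: eq_bigl => l.
    by rewrite neq_ltn orbC; case: ltngtP.
  by rewrite -leqNgt andbC ltn_neqAle andbC.
rewrite (eq_bigr _ (fun p _ => rowE p)) big_split /=; congr (_ + _).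
rewrite big_split /= [X in _ + X](exchange_big_dep xpredT)//= -big_split /=.
rewrite (upE (fun pl => 2 * F pl.1 pl.2)); apply: eq_bigr => p _.
rewrite -big_split /=; apply: eq_bigr => l _; rewrite (Fsym l p); ring.
Qed.

Definition coords_of_sym (R : realType) (r : nat) (C : 'M[R]_r) : sym_coords R r :=
  ([ffun p => C p p], [ffun pl => C (val pl).1 (val pl).2]).

(** [insub (p, l)] succeeds exactly when [p < l], so the three branches are the entries above, below
    and on the diagonal. *)
Definition sym_of_coords (R : realType) (r : nat) (c : sym_coords R r) : 'M[R]_r :=
  \matrix_(p, l)
    if insub (p, l) is Some pl then c.2 pl
    else if insub (l, p) is Some lp then c.2 lp else c.1 p.

Lemma sym_of_coords_sym (R : realType) (r : nat) (c : sym_coords R r) :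
  (sym_of_coords c)^T = sym_of_coords c.
Proof.
apply/matrixP => p l; rewrite !mxE.
case: (ltngtP p l) => pl.
- by rewrite insubF /= ?insubT// ltnNge ltnW.
- by rewrite insubT [in RHS]insubF /= ?insubT// ltnNge ltnW.
- by rewrite (val_inj pl).
Qed.

Lemma sym_of_coordsK (R : realType) (r : nat) :
  cancel (@sym_of_coords R r) (@coords_of_sym R r).
Proof.
case=> c1 c2; congr (_, _); apply/ffunP => p; rewrite ffunE mxE /=.
  by rewrite insubF //= ltnn.
by rewrite -surjective_pairing valK.
Qed.

Lemma coords_of_sym_eq0 (R : realType) (r : nat) (C : 'M[R]_r) :
  C^T = C -> coords_of_sym C = 0 -> C = 0.
Proof.
move=> Csym [/ffunP C1 /ffunP C2]; apply/matrixP => p l; rewrite [RHS]mxE.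
case: (ltngtP p l) => pl.
- by have := C2 (Sub (p, l) pl); rewrite !ffunE.
- by have := C2 (Sub (l, p) pl); rewrite !ffunE -[in C l p]Csym mxE.
- by rewrite (val_inj pl); have := C1 l; rewrite !ffunE.
Qed.

(** Links the coordinate formula to the extremality criterion, which tests only diagonal entries. *)
Lemma Lmap_coords_of_sym (R : realType) (m r : nat) (a : 'M[R]_(m, r))
    (C : 'M[R]_r) (s : 'I_m) :
  C^T = C -> Lmap a (coords_of_sym C) s 0 = (a *m C *m a^T) s s.
Proof.
move=> Csym; have Csw p l : C p l = C l p by rewrite -[in LHS]Csym mxE.
transitivity (\sum_p \sum_l a s p * C p l * a s l).
  rewrite sum_sym_upair => [|p l]; last by rewrite Csw; ring.
  rewrite mxE; congr (_ + _); apply: eq_bigr => p _; rewrite ffunE.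
    by rewrite real_normK ?num_real//; ring.
  by ring.
rewrite mxE exchange_big /=; apply: eq_bigr => l _.
by rewrite mxE [in RHS]mxE mulr_suml.
Qed.

(** Rank-nullity: the prescribed rank is the dimension of the source, so it forces a zero kernel. *)
Lemma lrank_L (R : realType) (m r : nat) (a : 'M[R]_(m, r)) :
  lrank (L a) = ((r ^ 2 + r) %/ 2)%N <-> (forall c, Lmap a c = 0 -> c = 0).
Proof.
have := limg_ker_dim (L a) fullv; rewrite dim_sym_coords capfv => dimE.
rewrite /lrank -dimE; split=> [|inj].
  rewrite -[LHS]add0n => /addIn /esym/eqP; rewrite dimv_eq0 => /eqP ker0 c Lc.
  by apply/eqP; rewrite -memv0 -ker0 memv_ker lfunE /= Lc.
suff -> : lker (L a) = 0%VS by rewrite dimv0 add0n.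
apply/eqP; rewrite -subv0; apply/subvP => c; rewrite memv_ker lfunE /= => /eqP.
by move=> /inj ->; rewrite mem0v.
Qed.

Lemma lrank_L_sym (R : realType) (m r : nat) (a : 'M[R]_(m, r)) :
  lrank (L a) = ((r ^ 2 + r) %/ 2)%N <->
  (forall C : 'M[R]_r, C^T = C -> (forall s, (a *m C *m a^T) s s = 0) -> C = 0).
Proof.
split=> [/lrank_L inj C Csym C0|inj].
  apply: coords_of_sym_eq0 => //; apply: inj; apply/colP => s.
  by rewrite Lmap_coords_of_sym// C0 mxE.
apply/lrank_L => c Lc; rewrite -[c]sym_of_coordsK (inj (sym_of_coords c)) ?sym_of_coords_sym//.
  by congr (_, _); apply/ffunP => p; rewrite !ffunE mxE.
move=> s; rewrite -Lmap_coords_of_sym ?sym_of_coords_sym//.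
by rewrite sym_of_coordsK Lc mxE.
Qed.

(** * [Atilde] as the matrix of [L] *)

Definition col_of_coords (R : realType) (r : nat) (c : sym_coords R r) :
    'cV[R]_(r + (r * r.-1)./2) :=
  col_mx (\col_p c.1 p)
    (\col_k c.2 (enum_val (cast_ord (esym (card_upair r)) k))).

Definition coords_of_col (R : realType) (r : nat)
    (v : 'cV[R]_(r + (r * r.-1)./2)) : sym_coords R r :=
  ([ffun p => usubmx v p 0],
   [ffun pl => dsubmx v (cast_ord (card_upair r) (enum_rank pl)) 0]).

Lemma col_of_coordsK (R : realType) (r : nat) :
  cancel (@col_of_coords R r) (@coords_of_col R r).
Proof.
case=> c1 c2; rewrite /coords_of_col col_mxKu col_mxKd.
congr (_, _); apply/ffunP => p; rewrite ffunE mxE//=.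
by rewrite cast_ordK enum_rankK.
Qed.

Lemma coords_of_colK (R : realType) (r : nat) :
  cancel (@coords_of_col R r) (@col_of_coords R r).
Proof.
move=> v; rewrite -[RHS]vsubmxK; congr col_mx; apply/colP => k.
  by rewrite mxE ffunE.
by rewrite mxE ffunE enum_valK cast_ordKV.
Qed.

Lemma Atilde_col_of_coords (R : realType) (m r : nat) (a : 'M[R]_(m, r)) c :
  Atilde a *m col_of_coords c = Lmap a c.
Proof.
apply/colP => s; rewrite mul_row_col !mxE; congr (_ + _).
  by apply: eq_bigr => p _; rewrite !mxE.
(* The columns of [Qmx] follow the enumeration of the pairs, so the second sum is reindexed along
   this bijection. *)
pose h k : upair r := enum_val (cast_ord (esym (card_upair r)) k).
rewrite [RHS](reindex h) /=; first by apply: eq_bigr => k _; rewrite !mxE.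
exists (fun pl => cast_ord (card_upair r) (enum_rank pl)) => x _.
  by rewrite /h enum_valK cast_ordKV.
by rewrite /h cast_ordK enum_rankK.
Qed.

(** Transposing turns full column rank into row freeness, that is, a zero left kernel. *)
Lemma rank_full_colP (R : realType) (m k : nat) (M : 'M[R]_(m, k)) :
  \rank M = k <-> (forall v : 'cV[R]_k, M *m v = 0 -> v = 0).
Proof.
rewrite -mxrank_tr; split=> [/eqP Mfree v Mv|inj].
  apply: trmx_inj; rewrite trmx0; apply: (row_free_inj Mfree).
  by rewrite -trmx_mul Mv trmx0 mul0mx.
apply/eqP; rewrite -[_ == _]/(row_free _) -kermx_eq0; apply/eqP/row_matrixP => i.
rewrite row0; apply: trmx_inj; rewrite trmx0; apply: inj.
by rewrite -{1}[M]trmxK -trmx_mul -row_mul mulmx_ker row0 trmx0.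
Qed.

Lemma size_sym_coords (r : nat) : (r + (r * r.-1)./2 = (r ^ 2 + r) %/ 2)%N.
Proof.
have -> : (r + (r * r.-1)./2 = (r.*2 + r * r.-1)./2)%N.
  by rewrite halfD odd_double doubleK.
by rewrite divn2; congr _./2; case: r => // r; lia.
Qed.

Lemma rank_Atilde (R : realType) (m r : nat) (a : 'M[R]_(m, r)) :
  \rank (Atilde a) = ((r ^ 2 + r) %/ 2)%N <-> (forall c, Lmap a c = 0 -> c = 0).
Proof.
rewrite -size_sym_coords; split=> [/rank_full_colP inj x|inj]; last apply/rank_full_colP => x.
  rewrite -Atilde_col_of_coords => /inj c0; rewrite -[x]col_of_coordsK c0.
  by congr (_, _); apply/ffunP => p; rewrite !ffunE !mxE.
rewrite -[x]coords_of_colK Atilde_col_of_coords => /inj ->.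
by apply/colP => k; rewrite !mxE; case: (fintype.split k) => j; rewrite !mxE ffunE.
Qed.

Theorem theorem2p12 (R : realType) (n m r : nat) (hm : (m <= n)%N)
    (hr : (r <= n)%N) (T A : 'M[R]_n) (lam : nat -> R)
    (hT : psd_contractions T)
    (hrank : \rank T = r)
    (hdiag1 : forall i : 'I_n, (i < m)%N -> T i i = 1)
    (hdiaglt : forall i : 'I_n, (m <= i)%N -> T i i < 1)
    (hA : orthogonal_mx A)
    (hlam_pos : forall i : nat, (i < r)%N -> 0 < lam i)
    (hlam_noninc : forall i j : nat, (i <= j)%N -> (j < r)%N -> lam j <= lam i)
    (hTA : T = A *m diag_lam n r lam *m A^T) :
  (extreme_contraction T
    <-> lrank (L (upper_left hm hr A)) = ((r ^ 2 + r) %/ 2)%N) /\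
  (lrank (L (upper_left hm hr A)) = ((r ^ 2 + r) %/ 2)%N
    <-> \rank (Atilde (upper_left hm hr A)) = ((r ^ 2 + r) %/ 2)%N).
Proof.
split; last by rewrite lrank_L rank_Atilde.
set a := upper_left hm hr A.
(* The zero eigenvalues cancel the remaining columns of [A], which leaves a factorization of [T]
   with a positive diagonal. *)
pose B : 'M[R]_(n, r) := colsub (widen_ord hr) A.
have lamB i j : T i j = \sum_(p < r) B i p * lam p * B j p.
  have E (k : 'I_n) : (A *m diag_lam n r lam) i k * A^T k j
      = if (k < r)%N then A i k * lam k * A j k else 0.
    by rewrite mul_mx_diag !mxE; case: ifP => _ //; rewrite mulr0 mul0r.
  rewrite hTA mxE (eq_bigr _ (fun k _ => E k)) -big_mkcond (big_ord_narrow hr) /=.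
  by apply: eq_bigr => p _; rewrite !mxE.
have BB : B^T *m B = 1%:M.
  apply/matrixP => p q.
  transitivity ((A^T *m A) (widen_ord hr p) (widen_ord hr q)).
    by rewrite !mxE; apply: eq_bigr => k _; rewrite !mxE.
  by rewrite hA.1 !mxE.
have TB : T = B *m diag_mx (\row_p lam p) *m B^T.
  apply/matrixP => i j; rewrite lamB mxE; apply: eq_bigr => p _.
  by rewrite mul_mx_diag !mxE.
rewrite (extreme_contractionP BB _ TB hT) => [|p]; last by rewrite mxE hlam_pos.
rewrite lrank_L_sym.
have aB (C : 'M[R]_r) s :
    (a *m C *m a^T) s s = (B *m C *m B^T) (widen_ord hm s) (widen_ord hm s).
  rewrite !mxE; apply: eq_bigr => p _; rewrite !mxE; congr (_ * _).
  by apply: eq_bigr => q _; rewrite !mxE.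
(* The indices with [T i i = 1] are exactly those below [m], which are the rows kept in [a]. *)
split=> inj C Csym C0; apply: inj => // i.
  move=> Ti; have im : (i < m)%N.
    by rewrite ltnNge; apply/negP => /hdiaglt; rewrite Ti ltxx.
  by rewrite -(C0 (Ordinal im)) aB; congr (_ _ _); apply: val_inj.
by rewrite aB C0// hdiag1 /=.
Qed.
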